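(* Let $\Omega\subset\mathbb C^d$ be a bounded domain such that $(\Omega,K_\Omega)$ is a complete metric space. Suppose $\Omega$ is visible. If $\{\gamma_k\}$ is a sequence of geodesics in $\Omega$, each of which is either a geodesic segment $\gamma_k:[0,R_k]\to\Omega$ with $0<R_k<+\infty$ or a geodesic ray $\gamma_k:[0,+\infty)\to\Omega$ (set $R_k=+\infty$ in this case), and $\{\gamma_k\}$ converges uniformly on compacta to a geodesic ray $\gamma:[0,+\infty)\to\Omega$, then $\{\gamma_k\}$ converges uniformly to $\gamma$.
   Context: $K_\Omega$ is the Kobayashi distance of $\Omega$; $|\cdot|$ is the Euclidean norm and $\partial\Omega$ the Euclidean boundary. Geodesics: a geodesic is a curve $\gamma:I\to\Omega$ ($I\subset\mathbb R$ an interval) with $K_\Omega(\gamma(s),\gamma(t))=|s-t|$ for all $s,t\in I$; it is a geodesic segment if $I$ is compact and a geodesic ray if $I=[a,+\infty)$. Visible: $\Omega$ is visible if for all $p,q\in\partial\Omega$ with $p\neq q$ there exist neighborhoods $V_p$ of $p$ and $V_q$ of $q$ with $V_p\cap V_q=\emptyset$ and a compact set $K\subset\Omega$ such that every geodesic segment joining a point $x\in V_p\cap\Omega$ to a point $y\in V_q\cap\Omega$ intersects $K$. In a visible, complete hyperbolic bounded domain every geodesic ray has a limit at $+\infty$, which is a point of $\partial\Omega$; a geodesic ray defined on $[0,+\infty)$ is then regarded as defined on $[0,+\infty]$, with value at $+\infty$ equal to this limit. Uniform convergence on compacta: for every $T>0$ one has $R_k\ge T$ for all large $k$ and $\gamma_k\to\gamma$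 uniformly on $[0,T]$. Uniform convergence: $\lim_{k\to\infty}R_k=+\infty$ and for every $\theta>0$ there is $k_0\in\mathbb N$ such that for every $k\ge k_0$ and every $t\in[0,R_k]$ (including $t=+\infty$ when $R_k=+\infty$) one has $|\gamma_k(t)-\gamma(t)|\le\theta$. *)

(* Defs.v *)
From HB Require Import structures.
From mathcomp Require Import all_boot all_order all_algebra.
From mathcomp Require Import complex.
From mathcomp Require Import all_classical all_reals all_analysis.

Set Implicit Arguments.
Unset Strict Implicit.
Unset Printing Implicit Defensive.

Import Order.TTheory GRing.Theory Num.Theory.
Import numFieldNormedType.Exports.

Local Open Scope classical_set_scope.
Local Open Scope ring_scope.

(* The normed module structure of the numFieldType [R[i]] over itself is only
   found through the alias [R[i]^o]; this makes it available on [R[i]], and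
   hence on the row vectors ['rV[R[i]]_d], which stand for C^d. *)
#[warnings="-redundant-canonical-projection"]
HB.instance Definition _ (R : rcfType) := NormedModule.copy R[i] R[i]^o.

Section Kobayashi.
Context {R : realType}.

(* The library norm of ['rV[R[i]]_d] is the maximum norm, with values in
   [R[i]]; it induces the same topology as this one. *)
Definition euclidean_norm d (z : 'rV[R[i]]_d) : R :=
  Num.sqrt (\sum_(j < d) Normc.normc (z 0 j) ^+ 2).

Definition euclidean_bounded d (A : set 'rV[R[i]]_d) : Prop :=
  exists M : R, forall z, A z -> euclidean_norm z <= M.

Definition boundary (T : topologicalType) (A : set T) : set T :=
  closure A `\` interior A.

Definition domain d (Omega : set 'rV[R[i]]_d) : Prop :=
  [/\ open Omega, connected Omega & Omega !=set0].

Definition unit_disc : set R[i] := [set z | Normc.normc z < 1].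

Definition poincare_distance (z w : R[i]) : R :=
  let m := Normc.normc ((z - w) / (1 - conjc w * z)) in
  ln ((1 + m) / (1 - m)) / 2.

(* [derivable] is taken over the field [R[i]]: this is complex
   differentiability at every point of the open disc. *)
Definition holomorphic_disc d (Omega : set 'rV[R[i]]_d)
    (phi : R[i] -> 'rV[R[i]]_d) : Prop :=
  forall z, unit_disc z -> Omega (phi z) /\ derivable phi z 1.

(* Lengths of the finite chains of holomorphic discs in Omega from x to y. *)
Definition chain_lengths d (Omega : set 'rV[R[i]]_d) (x y : 'rV[R[i]]_d) :
    set R :=
  [set l | exists (n : nat) (p : nat -> 'rV[R[i]]_d)
      (phi : nat -> R[i] -> 'rV[R[i]]_d) (a b : nat -> R[i]),
    [/\ p 0%N = x, p n = y,
        forall i, (i < n)%N ->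
          [/\ holomorphic_disc Omega (phi i),
              unit_disc (a i), unit_disc (b i),
              phi i (a i) = p i & phi i (b i) = p i.+1]
      & l = \sum_(i < n) poincare_distance (a i) (b i)]].

(* On a domain any two points are joined by a chain, so the infimum is taken
   over a nonempty set of nonnegative reals. *)
Definition kobayashi d (Omega : set 'rV[R[i]]_d) (x y : 'rV[R[i]]_d) : R :=
  inf (chain_lengths Omega x y).

Definition metric_on (T : Type) (A : set T) (dist : T -> T -> R) : Prop :=
  [/\ forall x y, A x -> A y -> 0 <= dist x y,
      forall x y, A x -> A y -> (dist x y = 0 <-> x = y),
      forall x y, A x -> A y -> dist x y = dist y x
    & forall x y z, A x -> A y -> A z -> dist x z <= dist x y + dist y z].

Definition complete_metric_on (T : Type) (A : set T) (dist : T -> T -> R) :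
    Prop :=
  metric_on A dist /\
  forall u : nat -> T, (forall n, A (u n)) ->
    (forall e : R, 0 < e -> exists N : nat,
       forall m n : nat, (N <= m)%N -> (N <= n)%N -> dist (u m) (u n) < e) ->
    exists2 l, A l & dist (u n) l @[n --> \oo] --> (0 : R).

(* Curves are total functions on R, used only on the interval I. *)
Definition geodesic d (Omega : set 'rV[R[i]]_d) (I : set R)
    (gamma : R -> 'rV[R[i]]_d) : Prop :=
  [/\ is_interval I,
      {within I, continuous gamma},
      forall t, I t -> Omega (gamma t)
    & forall s t, I s -> I t ->
        kobayashi Omega (gamma s) (gamma t) = `|s - t|].

Definition geodesic_segment d (Omega : set 'rV[R[i]]_d) (a b : R)
    (gamma : R -> 'rV[R[i]]_d) : Prop :=
  a <= b /\ geodesic Omega `[a, b] gamma.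

Definition geodesic_ray d (Omega : set 'rV[R[i]]_d) (a : R)
    (gamma : R -> 'rV[R[i]]_d) : Prop :=
  geodesic Omega `[a, +oo[ gamma.

Definition visible d (Omega : set 'rV[R[i]]_d) : Prop :=
  forall p q, boundary Omega p -> boundary Omega q -> p <> q ->
  exists Vp Vq K : set 'rV[R[i]]_d,
    [/\ nbhs p Vp, nbhs q Vq & Vp `&` Vq = set0] /\
    [/\ compact K, K `<=` Omega
      & forall (a b : R) (gamma : R -> 'rV[R[i]]_d),
          geodesic_segment Omega a b gamma -> Vp (gamma a) -> Vq (gamma b) ->
          exists2 t, a <= t <= b & K (gamma t)].

Definition segment_or_ray d (Omega : set 'rV[R[i]]_d) (r : \bar R)
    (gamma : R -> 'rV[R[i]]_d) : Prop :=
  (exists2 b : R, r = b%:E & 0 < b /\ geodesic_segment Omega 0 b gamma) \/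
  (r = +oo%E /\ geodesic_ray Omega 0 gamma).

(* The extension of a curve to infinite times by its limits. *)
Definition extended_curve d (gamma : R -> 'rV[R[i]]_d) (t : \bar R) :
    'rV[R[i]]_d :=
  match t with
  | s%:E%E => gamma s
  | +oo%E => lim (gamma s @[s --> +oo])
  | -oo%E => lim (gamma s @[s --> -oo])
  end.

Definition cvg_uniformly_on_compacta d (r : nat -> \bar R)
    (gamma_ : nat -> R -> 'rV[R[i]]_d) (gamma : R -> 'rV[R[i]]_d) : Prop :=
  forall T : R, 0 < T ->
    (\forall k \near \oo, (T%:E <= r k)%E) /\
    (forall e : R, 0 < e -> \forall k \near \oo,
       forall t : R, 0 <= t <= T ->
         euclidean_norm (gamma_ k t - gamma t) <= e).

Definition cvg_uniformly d (r : nat -> \bar R)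
    (gamma_ : nat -> R -> 'rV[R[i]]_d) (gamma : R -> 'rV[R[i]]_d) : Prop :=
  r k @[k --> \oo] --> +oo%E /\
  forall theta : R, 0 < theta -> exists k0 : nat,
    forall k, (k0 <= k)%N -> forall t : \bar R, (0 <= t <= r k)%E ->
      euclidean_norm (extended_curve (gamma_ k) t - extended_curve gamma t)
        <= theta.

End Kobayashi.

(* Main.v *)
(* A geodesic joining a point near p to a point near q, with p <> q in the
   boundary, meets a compact set, on which the distance to a base point is
   bounded; so its parameter there is bounded. Hence two late points of one
   geodesic (among those issued from a bounded set) cannot be near different
   boundary points, and by compactness of the closure the tails beyond a common
   time T oscillate uniformly little. This yields the limits of rays, and uniform
   convergence follows by comparing gamma_k and gamma at the time T. *)
Require Import Defs.
From mathcomp Require Import all_boot all_order all_algebra.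
From mathcomp Require Import complex.
From mathcomp Require Import all_classical all_reals all_analysis.
From mathcomp Require Import ring lra.

Set Implicit Arguments.
Unset Strict Implicit.
Unset Printing Implicit Defensive.
Import Order.TTheory GRing.Theory Num.Theory.
Import numFieldNormedType.Exports.
Import Normc.
Local Open Scope classical_set_scope.
Local Open Scope ring_scope.

(** * Topology of C^d through real-valued coordinate moduli *)

Section ComplexVectors.
Context {R : realType}.
Implicit Types (u v : R[i]) (e M : R).

Lemma normc_ge0 u : 0 <= normc u.
Proof. by case: u => a b; exact: sqrtr_ge0. Qed.

Lemma ler_normc u v : normc (u + v) <= normc u + normc v.
Proof. exact: (@le_normcD R u v). Qed.

Lemma normc_distC u v : normc (u - v) = normc (v - u).
Proof. by rewrite -opprB; exact: (@normcN R (v - u)). Qed.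

Lemma normc_triangle u v w : normc (u - w) <= normc (u - v) + normc (v - w).
Proof. by rewrite -[u - w](subrKA v) ler_normc. Qed.

Lemma nbhs_complexP u (P : set R[i]) :
  nbhs u P <-> exists2 e, 0 < e & forall w, normc (u - w) < e -> P w.
Proof.
rewrite nbhs_ballP; split=> [[[a b] ab0 abP]|[e e0 eP]].
  (* A positive element of [R[i]] is real, so the radius of a ball has imaginary part 0. *)
  have /andP[/eqP b0 a0] : (b == 0) && (0 < a) by move: ab0; rewrite /= ltcE.
  exists a => // w uw; apply: abP; rewrite b0 /ball /=.
  by change ((normc (u - w))%:C%C < a%:C%C); rewrite ltcR.
exists e%:C%C; first by rewrite /= ltcR.
move=> w uw; apply: eP; move: uw; rewrite /ball /=.
by change ((normc (u - w))%:C%C < e%:C%C -> normc (u - w) < e); rewrite ltcR.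
Qed.

(** Real radii and coordinatewise bounds link the topology, whose norm is [R[i]]-valued, to
    [euclidean_norm]. *)
Lemma nbhs_rVP d (x : 'rV[R[i]]_d) (P : set 'rV[R[i]]_d) :
  nbhs x P <->
  exists2 e, 0 < e & forall z, (forall j, normc ((x - z) 0 j) < e) -> P z.
Proof.
rewrite nbhs_ballP; split=> [[[a b] ab0 abP]|[e e0 eP]].
  have /andP[/eqP b0 a0] : (b == 0) && (0 < a) by move: ab0; rewrite /= ltcE.
  exists a => // w uw; apply: abP; rewrite b0; split; first by rewrite ltcR.
  move=> i j; rewrite /ball /= (ord1 i).
  change ((normc (x 0 j - w 0 j))%:C%C < a%:C%C); rewrite ltcR.
  by have := uw j; rewrite !mxE.
exists e%:C%C; first by rewrite /= ltcR.
move=> w [_ uw]; apply: eP => j; move: (uw 0 j); rewrite /ball /= !mxE.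
change ((normc (x 0 j - w 0 j))%:C%C < e%:C%C -> normc (x 0 j - w 0 j) < e).
by rewrite ltcR.
Qed.

Lemma normc_coord_le d (z : 'rV[R[i]]_d) j :
  normc (z 0 j) <= euclidean_norm z.
Proof.
rewrite /euclidean_norm -[leLHS](ger0_norm (normc_ge0 _)) -sqrtr_sqr.
rewrite ler_wsqrtr// (bigD1 j)//= lerDl sumr_ge0// => k _.
exact: sqr_ge0.
Qed.

Lemma euclidean_norm_le d (z : 'rV[R[i]]_d) e : 0 <= e ->
  (forall j, normc (z 0 j) <= e) -> euclidean_norm z <= e * d%:R.
Proof.
move=> e0 ze; rewrite -[leRHS]ger0_norm ?mulr_ge0// -sqrtr_sqr.
rewrite ler_wsqrtr//; apply: (@le_trans _ _ (\sum_(j < d) e ^+ 2)).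
  by apply: ler_sum => j _; rewrite lerXn2r ?nnegrE ?normc_ge0.
(* The crude factor [d] instead of its square root comes from d e^2 <= d^2 e^2, true also for d =
   0. *)
rewrite sumr_const card_ord -[leLHS]mulr_natr exprMn ler_wpM2l ?sqr_ge0//.
by rewrite -natrX ler_nat; case: d {z ze} => // d; rewrite leq_pmulr.
Qed.

(** The box is the image of a compact real square under the continuous map (a, b) |-> a + ib. *)
Lemma complex_box_compact M :
  compact [set u : R[i] | `|complex.Re u| <= M /\ `|complex.Im u| <= M].
Proof.
pose f (p : R * R) : R[i] := (p.1 +i* p.2)%C.
have -> : [set u : R[i] | `|complex.Re u| <= M /\ `|complex.Im u| <= M] =
    f @` (`[- M, M] `*` `[- M, M]).
  apply/seteqP; split=> [[a b] /= [aM bM]|_ [[a b] /= [aM bM] <-]] /=.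
    by exists (a, b) => //; split; rewrite /= in_itv /= -ler_norml.
  by move: aM bM; rewrite !in_itv /= -!ler_norml.
apply: continuous_compact; last by apply: compact_setX; exact: segment_compact.
apply: continuous_subspaceT => -[a b] P /nbhs_complexP[e e0 eP].
have e20 : 0 < e / 2 by rewrite divr_gt0.
exists (ball a (e / 2), ball b (e / 2)).
  by split; exact: nbhsx_ballx.
move=> [a' b'] [/= aa' bb']; apply: eP.
have -> : (f (a, b) - f (a', b') : R[i]) = ((a - a')%:C + (0 +i* (b - b')))%C.
  by rewrite /f /=; simpc.
apply: le_lt_trans (ler_normc _ _) _.
rewrite /normc /= !expr0n /= add0r addr0 !sqrtr_sqr.
by rewrite [e]splitr ltrD.
Qed.

Lemma rV_box_compact d M :
  compact [set z : 'rV[R[i]]_d |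
    forall j, `|complex.Re (z 0 j)| <= M /\ `|complex.Im (z 0 j)| <= M].
Proof.
pose box : set R[i] := [set u | `|complex.Re u| <= M /\ `|complex.Im u| <= M].
by apply: (@rV_compact R[i] d (fun=> box)) => _; exact: complex_box_compact.
Qed.

Lemma le_normc_Re u : `|complex.Re u| <= normc u.
Proof.
by case: u => a b /=; rewrite -sqrtr_sqr ler_wsqrtr// lerDl sqr_ge0.
Qed.

Lemma le_normc_Im u : `|complex.Im u| <= normc u.
Proof.
by case: u => a b /=; rewrite -sqrtr_sqr ler_wsqrtr// lerDr sqr_ge0.
Qed.

Lemma euclidean_bounded_sub_compact d (A : set 'rV[R[i]]_d) :
  euclidean_bounded A -> exists2 C, compact C & A `<=` C.
Proof.
move=> [M AM]; eexists; first exact: (@rV_box_compact d M).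
move=> z /AM zM j; split.
  exact: le_trans (le_normc_Re _) (le_trans (normc_coord_le _ _) zM).
exact: le_trans (le_normc_Im _) (le_trans (normc_coord_le _ _) zM).
Qed.

End ComplexVectors.

(** * Upper bounds for the Kobayashi distance from holomorphic discs *)

Section KobayashiBounds.
Context {R : realType} {d : nat}.
Implicit Types (Omega : set 'rV[R[i]]_d) (x y z v : 'rV[R[i]]_d).

(* If the quotient [m] is at least 1, the argument of [ln] is nonpositive (0 for
   [m = 1], by division by zero), where [ln] is 0. *)
Lemma poincare_distance_ge0 (a b : R[i]) : 0 <= poincare_distance a b.
Proof.
rewrite /poincare_distance divr_ge0//; set m := normc _.
have m0 : 0 <= m by exact: normc_ge0.
have [m1|m1] := ltP m 1.
  by rewrite ln_ge0// ler_pdivlMr ?subr_gt0// mul1r; lra.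
by rewrite ln0// pmulr_rle0 ?invr_le0 ?subr_le0// ltr_wpDr.
Qed.

Lemma kobayashi_le_disc Omega (phi : R[i] -> 'rV[R[i]]_d) (a b : R[i]) :
  holomorphic_disc Omega phi -> unit_disc a -> unit_disc b ->
  kobayashi Omega (phi a) (phi b) <= poincare_distance a b.
Proof.
move=> hphi ha hb; apply: ge_inf.
  exists 0 => _ [n [p [f [s [t [_ _ _ ->]]]]]].
  by apply: sumr_ge0 => i _; exact: poincare_distance_ge0.
(* A single disc is a chain with one link. *)
exists 1%N, (fun k => if k == 0%N then phi a else phi b), (fun=> phi).
exists (fun=> a), (fun=> b); split => //.
  by case.
by rewrite big_ord1.
Qed.

Lemma derivable_affine x v (a : R[i]) :
  derivable (fun w : R[i] => x + w *: v) a 1.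
Proof.
apply/cvg_ex; exists v; apply: cvg_near_cst.
near=> h; have h0 : h != 0 by near: h; exact: nbhs_dnbhs_neq.
rewrite /= [h%:A]mulr1 scalerDl addrCA addrK scalerA mulVf// scale1r.
Unshelve. all: by end_near. Qed.

(** Near [x] the complex line through [x] and [z] contains an affine disc inside [Omega] on which
    both points have parameters independent of [z]. This is the only comparison needed between the
    Kobayashi distance and the Euclidean topology. *)
Lemma kobayashi_locally_bounded Omega x : open Omega -> Omega x ->
  \forall z \near x, Omega z /\
    kobayashi Omega x z <= poincare_distance 0 (2^-1 : R[i]).
Proof.
move=> oO Ox.
have /nbhs_rVP[e e0 eO] : nbhs x Omega by exact: open_nbhs_nbhs.
apply/nbhs_rVP; exists (e / 2); first by rewrite divr_gt0.
move=> z xz; split.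
  apply: eO => j; apply: lt_trans (xz j) _.
  by rewrite ltr_pdivrMr// mulr_natr mulr2n ltrDr.
(* The factor 2 places [z] at parameter 1/2; since the coordinates of z - x are below e/2, the whole
   unit disc stays within e of [x]. *)
pose phi (w : R[i]) := x + w *: (2 *: (z - x)).
have phi0 : phi 0 = x by rewrite /phi scale0r addr0.
have phi2 : phi 2^-1 = z.
  by rewrite /phi scalerA mulVf ?pnatr_eq0// scale1r addrC subrK.
rewrite -{1}phi0 -{1}phi2; apply: kobayashi_le_disc.
- move=> w w1; split; last exact: derivable_affine.
  apply: eO => j; rewrite /phi !mxE.
  have -> : x 0 j - (x 0 j + w * (2 * (z 0 j - x 0 j))) =
      w * (2 * (x 0 j - z 0 j)) by ring.
  have n2 : normc (2 : R[i]) = 2 by rewrite (@normcMn R 1 2) normc1.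
  rewrite !normcM n2.
  have := xz j; rewrite !mxE => xzj.
  have := normc_ge0 (x 0 j - z 0 j); set q := normc _ in xzj * => q0.
  have := normc_ge0 w; move: w1; rewrite /unit_disc /=; set p := normc _.
  nra.
- by change (normc (0 : R[i]) < 1); rewrite normc0.
- change (normc (2^-1 : R[i]) < 1).
  by rewrite normcV (@normcMn R 1 2) normc1; lra.
Qed.

End KobayashiBounds.

(** Cluster points visited at arbitrarily late indices take the place of convergent subsequences. *)
Lemma compact_seq_cluster (T : topologicalType) (K : set T) (u : nat -> T) :
  compact K -> (forall n, K (u n)) ->
  exists2 p, K p & forall U N, nbhs p U -> exists2 n, (N <= n)%N & U (u n).
Proof.
move=> cK uK; have [p [Kp clp]] : K `&` cluster (u @ \oo) !=set0.
  by apply: cK; exists 0%N => // n _; exact: uK.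
exists p => // U N pU.
have NF : (u @ \oo) (u @` [set n | (N <= n)%N]).
  by exists N => // n Nn; exists n.
have [x [[n Nn <-] Ux]] := clp _ U NF pU.
by exists n.
Qed.

(** * Visibility and the late behaviour of geodesics *)

Section VisibleDomain.
Context {R : realType} {d : nat} (Omega : set 'rV[R[i]]_d).
Implicit Types (x y z o p q : 'rV[R[i]]_d) (I : set R).
Implicit Types (eta : R -> 'rV[R[i]]_d).

Lemma kobayashi_bounded_near o p :
  metric_on Omega (kobayashi Omega) -> open Omega -> Omega o -> Omega p ->
  exists M, \forall z \near p, kobayashi Omega o z <= M.
Proof.
move=> [_ _ _ tri] oO Oo Op.
exists (kobayashi Omega o p + poincare_distance 0 (2^-1 : R[i])).
have := kobayashi_locally_bounded oO Op; apply: filterS => z [Oz pz].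
by apply: le_trans (tri o p z Oo Op Oz) _; rewrite lerD2l.
Qed.

(** Otherwise points of [K] with distance to [o] above n would cluster at a point of [K], near which
    this distance is bounded. *)
Lemma kobayashi_bounded_compact o (K : set 'rV[R[i]]_d) :
  metric_on Omega (kobayashi Omega) -> open Omega -> Omega o ->
  compact K -> K `<=` Omega ->
  exists M, forall z, K z -> kobayashi Omega o z <= M.
Proof.
move=> mO oO Oo cK KO; apply: contrapT => /forallNP nM.
have /choice[u uP] n : exists z, K z /\ n%:R < kobayashi Omega o z.
  have /existsNP[z /not_implyP[Kz /negP]] := nM n%:R.
  by rewrite -ltNge; exists z.
have [p Kp pU] := compact_seq_cluster cK (fun n => (uP n).1).
have [M pM] := kobayashi_bounded_near mO oO Oo (KO _ Kp).
have [n Mn unM] := pU _ (Num.trunc M).+1 pM.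
have := lt_le_trans (uP n).2 unM; apply/negP; rewrite -leNgt.
by apply: le_trans (ltW (truncnS_gt M)) _; rewrite ler_nat.
Qed.

(** A cluster point inside [Omega] would have a neighbourhood of bounded distance to [o], against
    the growth of the distances. *)
Lemma unbounded_cluster_boundary o p (u : nat -> 'rV[R[i]]_d) (M : R) :
  metric_on Omega (kobayashi Omega) -> open Omega -> Omega o ->
  (forall n, Omega (u n)) -> (forall n, n%:R <= M + kobayashi Omega o (u n)) ->
  (forall U N, nbhs p U -> exists2 n, (N <= n)%N & U (u n)) ->
  boundary Omega p.
Proof.
move=> mO oO Oo Ou uoo pU; split.
  by move=> U /(pU _ 0%N)[n _ Un]; exists (u n); split; first exact: Ou.
move=> /interior_subset Op.
have [B pB] := kobayashi_bounded_near mO oO Oo Op.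
have [n Mn unM] := pU _ (Num.trunc (M + B)).+1 pB.
have : n%:R <= M + B by apply: le_trans (uoo n) _; rewrite lerD2l.
apply/negP; rewrite -ltNge.
by apply: lt_le_trans (truncnS_gt (M + B)) _; rewrite ler_nat.
Qed.

Lemma geodesic_dist_ge o (M : R) I eta (t : R) :
  metric_on Omega (kobayashi Omega) -> Omega o -> geodesic Omega I eta ->
  I 0 -> kobayashi Omega o (eta 0) <= M -> I t ->
  t <= M + kobayashi Omega o (eta t).
Proof.
move=> [_ _ sym tri] Oo [_ _ IO dist] I0 h0 It.
apply: (@le_trans _ _ (kobayashi Omega (eta 0) (eta t))).
  by rewrite dist// sub0r normrN ler_norm.
apply: le_trans (tri _ o _ (IO _ I0) Oo (IO _ It)) _.
by rewrite lerD2r (sym _ o (IO _ I0) Oo).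
Qed.

Lemma geodesic_restrict I eta (a b : R) :
  geodesic Omega I eta -> I a -> I b -> a <= b ->
  geodesic_segment Omega a b eta.
Proof.
move=> [Iitv Icont IO dist] Ia Ib ab; split => //.
have sub : `[a, b] `<=` I.
  by move=> t /=; rewrite in_itv /=; exact: Iitv Ia Ib t.
split=> [||t /sub/IO//|s t /sub Is /sub It]; last exact: dist.
  exact: interval_is_interval.
exact: continuous_subspaceW sub Icont.
Qed.

(** The piece of the geodesic from [a] to [b] meets the compact set of visibility at some t >= a,
    and there t is bounded by [M] plus the largest distance from [o]. The threshold [T] is thus
    common to all geodesics starting within [M] of [o]. *)
Lemma visible_separation o (M : R) p q :
  metric_on Omega (kobayashi Omega) -> open Omega -> visible Omega ->
  Omega o -> boundary Omega p -> boundary Omega q -> p <> q ->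
  exists Vp Vq T, [/\ nbhs p Vp, nbhs q Vq & forall I eta a b,
    geodesic Omega I eta -> I 0 -> kobayashi Omega o (eta 0) <= M ->
    T <= a -> a <= b -> I a -> I b -> Vp (eta a) -> ~ Vq (eta b)].
Proof.
move=> mO oO vO Oo bp bq pq.
have [Vp [Vq [K [[pVp qVq _] [cK KO meetK]]]]] := vO _ _ bp bq pq.
have [B KB] := kobayashi_bounded_compact mO oO Oo cK KO.
(* The summand 1 makes t >= T incompatible with t <= M + B. *)
exists Vp, Vq, (M + B + 1); split=> // I eta a b geta I0 h0 Ta ab Ia Ib Va Vb.
have [t /andP[at_ tb] Kt] := meetK a b eta (geodesic_restrict geta Ia Ib ab) Va Vb.
have It : I t by case: geta => Iitv _ _ _; apply: (Iitv a b) => //; rewrite at_.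
have := geodesic_dist_ge mO Oo geta I0 h0 It.
have := KB _ Kt; lra.
Qed.

(** If it fails, each n gives a geodesic with two points at times beyond n that are [theta] apart in
    some coordinate. These pairs cluster at two distinct boundary points, which [visible_separation]
    forbids. *)
Lemma visible_tail_oscillation o (M theta : R) :
  metric_on Omega (kobayashi Omega) -> open Omega -> euclidean_bounded Omega ->
  visible Omega -> Omega o -> 0 < theta ->
  exists T, forall I eta a b,
    geodesic Omega I eta -> I 0 -> kobayashi Omega o (eta 0) <= M ->
    T <= a -> a <= b -> I a -> I b ->
    forall j, normc ((eta a - eta b) 0 j) <= theta.
Proof.
move=> mO oO bO vO Oo th0; apply: contrapT => /forallNP nT.
(* Both endpoints are kept in one sequence of pairs, so that they come close to [p] and [q] at the
   same indices. *)
have /choice[u uP] n : exists u : 'rV[R[i]]_d * 'rV[R[i]]_d,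
    exists I eta a b, [/\ geodesic Omega I eta, I 0,
      kobayashi Omega o (eta 0) <= M & [/\ n%:R <= a, a <= b, I a & I b]] /\
      [/\ u = (eta a, eta b) & exists j, theta < normc ((u.1 - u.2) 0 j)].
  have := nT n%:R.
  move=> /existsNP[I] /existsNP[eta] /existsNP[a] /existsNP[b].
  move=> /not_implyP[g] /not_implyP[I0] /not_implyP[h0] /not_implyP[na].
  move=> /not_implyP[ab] /not_implyP[Ia] /not_implyP[Ib] /existsNP[j /negP].
  rewrite -ltNge => thj.
  by exists (eta a, eta b), I, eta, a, b; split=> //; split=> //; exists j.
have [C cC OC] := euclidean_bounded_sub_compact bO.
have uO n : Omega (u n).1 /\ Omega (u n).2.
  have [I [eta [a [b [[[_ _ IO _] _ _ [_ _ Ia Ib]] [-> _]]]]]] := uP n.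
  by split; exact: IO.
have uC n : (C `*` C) (u n) by split; apply: OC; have [] := uO n.
have [[p q] _ pqU] := compact_seq_cluster (compact_setX cC cC) uC.
have pU U N : nbhs p U -> exists2 n, (N <= n)%N & U (u n).1.
  move=> Up; have [|n Nn [/= U1 _]] := pqU (U `*` setT) N.
    by exists (U, setT) => //; split => //; exact: filterT.
  by exists n.
have qU U N : nbhs q U -> exists2 n, (N <= n)%N & U (u n).2.
  move=> Uq; have [|n Nn [/= _ U2]] := pqU (setT `*` U) N.
    by exists (setT, U) => //; split => //; exact: filterT.
  by exists n.
have bp : boundary Omega p.
  apply: (@unbounded_cluster_boundary o p (fun n => (u n).1) M mO oO Oo _ _ pU) => n.
    by have [] := uO n.
  have [I [eta [a [b [[g I0 h0 [na _ Ia _]] [-> _]]]]]] := uP n.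
  exact: le_trans na (geodesic_dist_ge mO Oo g I0 h0 Ia).
have bq : boundary Omega q.
  apply: (@unbounded_cluster_boundary o q (fun n => (u n).2) M mO oO Oo _ _ qU) => n.
    by have [] := uO n.
  have [I [eta [a [b [[g I0 h0 [na ab _ Ib]] [-> _]]]]]] := uP n.
  exact: le_trans (le_trans na ab) (geodesic_dist_ge mO Oo g I0 h0 Ib).
have pq : p <> q.
  move=> pq; subst q.
  (* If p = q, a pair with both points within theta/2 of [p] would be less than [theta] apart in
     every coordinate. *)
  pose U := [set z | forall j, normc ((p - z) 0 j) < theta / 2].
  have Up : nbhs p U by apply/nbhs_rVP; exists (theta / 2); rewrite ?divr_gt0.
  have [|n _ [/= U1 U2]] := pqU (U `*` U) 0%N; first by exists (U, U).
  have [I [eta [a [b [_ [_ [j]]]]]]] := uP n.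
  have := normc_triangle ((u n).1 0 j) (p 0 j) ((u n).2 0 j).
  rewrite [normc (_ - p 0 j)]normc_distC.
  by have := U1 j; have := U2 j; rewrite !mxE; lra.
have [Vp [Vq [T [pVp qVq VT]]]] := @visible_separation o M p q mO oO vO Oo bp bq pq.
have [|n Tn [/= Vp1 Vq1]] := pqU (Vp `*` Vq) (Num.trunc T).+1.
  by exists (Vp, Vq).
have [I [eta [a [b [[g I0 h0 [na ab Ia Ib]] [uE _]]]]]] := uP n.
rewrite uE /= in Vp1 Vq1.
apply: (VT I eta a b g I0 h0 _ ab Ia Ib Vp1 Vq1).
apply: le_trans na; apply: le_trans (ltW (truncnS_gt T)) _.
by rewrite ler_nat.
Qed.

End VisibleDomain.

(** * Limits of rays and tails including infinite time *)

Section Tails.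
Context {R : realType} {d : nat}.
Implicit Types (Omega : set 'rV[R[i]]_d) (eta : R -> 'rV[R[i]]_d) (r : \bar R).

(** Compactness supplies a cluster point, and small oscillation of the tails turns it into the
    limit. *)
Lemma cauchy_at_infinity_cvg (C : set 'rV[R[i]]_d) eta :
  compact C -> (forall t, 0 <= t -> C (eta t)) ->
  (forall theta, 0 < theta -> exists T, forall a b, T <= a -> a <= b ->
    forall j, normc ((eta a - eta b) 0 j) <= theta) ->
  cvg (eta s @[s --> +oo]).
Proof.
move=> cC Ceta cauchy.
have [p [_ clp]] : C `&` cluster (eta s @[s --> +oo]) !=set0.
  apply: cC; exists 0; split; first exact: real0.
  by move=> t /ltW; exact: Ceta.
apply/cvg_ex; exists p => P /nbhs_rVP[e e0 eP].
have e20 : 0 < e / 2 by rewrite divr_gt0.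
have e40 : 0 < e / 4 by rewrite divr_gt0.
have [T Tosc] := cauchy _ e40.
have Tinf : (eta s @[s --> +oo]) (eta @` [set s | T <= s]).
  exists T; split; first exact: num_real.
  by move=> s Ts; exists s => //; exact: ltW.
have pe : nbhs p [set z | forall j, normc ((p - z) 0 j) < e / 4].
  by apply/nbhs_rVP; exists (e / 4).
have [_ [[s Ts <-] /= ps]] := clp _ _ Tinf pe.
exists s; split; first exact: num_real.
move=> t st; apply: eP => j.
have := normc_triangle (p 0 j) (eta s 0 j) (eta t 0 j).
have := Tosc s t Ts (ltW st) j; have := ps j; rewrite !mxE; lra.
Qed.

(** A single description of the time interval lets segments and rays be treated together. *)
Lemma segment_or_ray_geodesic Omega r eta : segment_or_ray Omega r eta ->
  geodesic Omega [set s | 0 <= s /\ (s%:E <= r)%E] eta.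
Proof.
move=> [[b -> [b0 [_ geta]]]|[-> geta]].
  rewrite (_ : [set s | _] = `[0, b]%classic)//.
  by apply/seteqP; split=> s /=; rewrite in_itv /= lee_fin => /andP.
rewrite (_ : [set s | _] = `[0, +oo[%classic)//.
by apply/seteqP; split=> s /=; rewrite in_itv /= andbT leey => // -[].
Qed.

Lemma visible_extended_tail Omega o (M theta : R) :
  metric_on Omega (kobayashi Omega) -> open Omega -> euclidean_bounded Omega ->
  visible Omega -> Omega o -> 0 < theta ->
  exists2 T, 0 < T & forall r eta, segment_or_ray Omega r eta ->
    kobayashi Omega o (eta 0) <= M ->
    forall t : \bar R, (T%:E <= t <= r)%E ->
    forall j, normc ((eta T - extended_curve eta t) 0 j) <= theta.
Proof.
move=> mO oO bO vO Oo th0.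
have th20 : 0 < theta / 2 by rewrite divr_gt0.
have [T0 oscT0] := visible_tail_oscillation M mO oO bO vO Oo th20.
(* Positivity puts [T] in the domain of the curves and allows convergence on [0, T] to be invoked
   later. *)
pose T := Num.max T0 1; exists T; first by rewrite /T lt_max ltr01 orbT.
have T0T : T0 <= T by rewrite /T le_max lexx.
have T1 : 0 <= T by rewrite /T le_max ler01 orbT.
move=> r eta etar eta0 t /andP[Tt tr].
have geta := segment_or_ray_geodesic etar.
have I0 : (0 <= r)%E by apply: le_trans tr; apply: le_trans Tt; rewrite lee_fin.
have osc s j : T <= s -> (s%:E <= r)%E ->
    normc ((eta T - eta s) 0 j) <= theta / 2.
  move=> Ts sr; apply: (oscT0 _ _ _ _ geta) => //; split => //.
    exact: le_trans Tt tr.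
  exact: le_trans Ts.
move: t Tt tr => [s| |] //.
  rewrite lee_fin => Ts sr j; apply: le_trans (osc s j Ts sr) _.
  by rewrite ler_pdivrMr// mulr_natr mulr2n lerDr ltW.
(* At t = +oo the curve is a ray. Its limit must be shown to exist before [lim] has a meaning; the
   estimate then passes through a late finite time, at the cost of a second theta/2. *)
move=> _; rewrite leye_eq => /eqP rE j; subst r.
have [C cC OC] := euclidean_bounded_sub_compact bO.
have etacvg : cvg (eta s @[s --> +oo]).
  apply: (cauchy_at_infinity_cvg cC) => [s s0|e e0].
    by apply: OC; case: geta => _ _ + _; apply; split; rewrite ?leey.
  have [S oscS] := visible_tail_oscillation M mO oO bO vO Oo e0.
  exists (Num.max S 0) => a b; rewrite ge_max => /andP[Sa a0] ab.
  apply: (oscS _ _ _ _ geta) => //; rewrite ?leey//; split; rewrite ?leey//.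
  exact: le_trans ab.
rewrite /extended_curve; set l := lim _.
have le2 : nbhs l [set z | forall j, normc ((l - z) 0 j) < theta / 2].
  by apply/nbhs_rVP; exists (theta / 2).
have [S [_ Sl]] := etacvg _ le2.
(* Neighbourhoods of +oo are given by strict inequalities, hence [S + 1]. *)
pose s := Num.max (S + 1) T.
have Ss : S < s by rewrite /s lt_max ltrDl ltr01.
have Ts : T <= s by rewrite /s le_max lexx orbT.
have := normc_triangle (eta T 0 j) (eta s 0 j) (l 0 j).
have := osc s j Ts (leey _); have := Sl s Ss j.
rewrite [normc ((l - _) 0 j)](_ : _ = normc (eta s 0 j - l 0 j)); last first.
  by rewrite !mxE normc_distC.
rewrite !mxE; lra.
Qed.

End Tails.

(** * Uniform convergence by comparison at a common time *)

Theorem lemma3p1 (R : realType) (d : nat) (Omega : set 'rV[R[i]]_d)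
    (Omega_domain : domain Omega)
    (Omega_bounded : euclidean_bounded Omega)
    (Omega_complete : complete_metric_on Omega (kobayashi Omega))
    (Omega_visible : visible Omega)
    (r : nat -> \bar R) (gamma_ : nat -> R -> 'rV[R[i]]_d)
    (gamma_geodesic : forall k, segment_or_ray Omega (r k) (gamma_ k))
    (gamma : R -> 'rV[R[i]]_d)
    (gamma_ray : geodesic_ray Omega 0%R gamma)
    (gamma_cvg : cvg_uniformly_on_compacta r gamma_ gamma) :
  cvg_uniformly r gamma_ gamma.
Proof.
split.
  apply/cvgeyPge => A.
  (* Convergence on compacta speaks only of positive times, hence the maximum with 1. *)
  have [] := gamma_cvg (Num.max A 1); first by rewrite lt_max ltr01 orbT.
  move=> + _; apply: filterS => k; apply: le_trans.
  by rewrite lee_fin le_max lexx.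
move=> theta theta0.
have [oO _ _] := Omega_domain; have [mO _] := Omega_complete.
have O0 : Omega (gamma 0).
  by case: gamma_ray => _ _ + _; apply; rewrite /= in_itv /= lexx.
(* With base point [gamma 0], this is the local bound of [kobayashi_locally_bounded], so it covers
   the starting points of [gamma_ k] for all large k. *)
pose M := @poincare_distance R 0 2^-1.
(* Three errors of size [e] will be added, so 5 leaves slack; [d.+1] absorbs the factor [d] of
   [euclidean_norm_le] and is never 0. *)
pose e := theta / (5 * d.+1%:R).
have e0 : 0 < e by rewrite divr_gt0// mulr_gt0.
have [T T0 tail] :=
  visible_extended_tail M mO oO Omega_bounded Omega_visible O0 e0.
have gamma_init : kobayashi Omega (gamma 0) (gamma 0) <= M.
  case: mO => _ /(_ _ _ O0 O0)[_ ->//] _ _; exact: poincare_distance_ge0.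
have /nbhs_rVP[c c0 cM] := kobayashi_locally_bounded oO O0.
have [rT gammaT] := gamma_cvg T T0.
have c20 : 0 < c / 2 by rewrite divr_gt0.
(* Closeness [e] is used up to time [T]; closeness c/2, used at time 0, yields the strict bound by
   [c] from a non-strict one. *)
have [k0 _ k0P] : \forall k \near \oo, (T%:E <= r k)%E /\
    ((forall t, 0 <= t <= T -> euclidean_norm (gamma_ k t - gamma t) <= e) /\
     (forall t, 0 <= t <= T -> euclidean_norm (gamma_ k t - gamma t) <= c / 2)).
  near=> k; split; first by near: k.
  by split; near: k; exact: gammaT.
exists k0 => k /k0P[Tr [close_e close_c]] t /andP[t0 tr].
suff coord j : normc ((extended_curve (gamma_ k) t - extended_curve gamma t) 0 j)
    <= 5 * e.
  apply: le_trans (euclidean_norm_le _ coord) _; first by rewrite mulr_ge0// ltW.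
  have -> : 5 * e * d%:R = theta * (d%:R / d.+1%:R).
    by rewrite /e; field; rewrite nat1r pnatr_eq0.
  by rewrite ler_piMr ?(ltW theta0)// ler_pdivrMr// mul1r ler_nat.
have [tT|Tt] := leP t T%:E.
  case: t t0 tr tT => [t| |]//; rewrite !lee_fin => t0 _ tT /=.
  apply: le_trans (normc_coord_le _ _) _.
  apply: le_trans (close_e t _) _; first by rewrite t0.
  lra.
have TT : 0 <= T <= T by rewrite lexx (ltW T0).
have gammak_init : kobayashi Omega (gamma 0) (gamma_ k 0) <= M.
  apply: (cM _ _).2 => i.
  have := le_trans (normc_coord_le _ i) (close_c 0 _).
  rewrite lexx (ltW T0) => /(_ isT).
  rewrite !mxE normc_distC; lra.
have tail_k := tail _ _ (gamma_geodesic k) gammak_init t _ j.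
(* The limit ray obeys the same tail estimate with the same [T]. *)
have tail_gamma := tail +oo%E gamma (or_intror (conj erefl gamma_ray)) gamma_init t _ j.
move: tail_k tail_gamma; rewrite (ltW Tt) tr leey => /(_ isT) h1 /(_ isT) h2.
have h3 := le_trans (normc_coord_le _ j) (close_e T TT).
move: h1 h2 h3; rewrite !mxE.
set x := extended_curve _ t; set y := extended_curve _ t.
(* The path from [x] to [y] goes through [gamma_ k T] and [gamma T]: tail, comparison at [T],
   tail. *)
have := normc_triangle (x 0 j) (gamma_ k T 0 j) (y 0 j).
have := normc_triangle (gamma_ k T 0 j) (gamma T 0 j) (y 0 j).
rewrite [normc (x 0 j - gamma_ k T 0 j)]normc_distC; lra.
Unshelve. all: by end_near.
Qed.
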